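(* For $r,s\in\mathbb N$ such that $m=\max(r,s)\geq1$, let $1\leq\lambda_1<\cdots<\lambda_s\leq r$ and $\Lambda=\{\lambda_1,\dots,\lambda_s\}$ if $r\geq s$, or let $1\leq\sigma_1<\cdots<\sigma_r\leq s$, $\sigma_{r+1}=s+1$, and $\Sigma=\{\sigma_1,\dots,\sigma_r,s+1\}$ if $r\leq s$, and define $$g_k(t)={}_{r+1}F_s\left(\left.\begin{matrix}a_1^{(k)},\dots,a_{r+1}^{(k)}\\ b_1^{(k)},\dots,b_s^{(k)}\end{matrix}\,\right|\,t\right)\qquad\text{for any }k\geq-1,$$ where $$a_i^{(k)}=a_i+\left\lceil\frac{k+1-i}{r+1}\right\rceil\quad\text{and}\quad b_j^{(k)}=b_j+\left\lceil\frac{k+1-\lambda_j}{r}\right\rceil\quad\text{if }r\geq s,$$ or $$a_i^{(k)}=a_i+\left\lceil\frac{k+1-\sigma_i}{s+1}\right\rceil\quad\text{and}\quad b_j^{(k)}=b_j+\left\lceil\frac{k+1-j}{s}\right\rceil\quad\text{if }r\leq s.$$ Then, the ratios of contiguous hypergeometric series $f_k(t)=\dfrac{g_k(t)}{g_{k-1}(t)}$, $k\in\mathbb N$, admit an $m$-branched-continued-fraction representation with coefficients $(\alpha_{k+m})_{k\in\mathbb N}$ defined as follows. If $r\geq s$: $$\alpha_{k+r}=\frac{\prod_{i=1,\,i\neq[k]_{r+1}}^{r+1}a_i^{(k)}}{\prod_{j=1}^{s}b_j^{(k)}}=\frac{\prod_{i=1}^{r}a'_{k-i}}{\prod_{1\leq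 i\leq r-1,\ [k-i]_r\in\Lambda}b'_{k-i}}\qquad\text{if }[k]_r\notin\Lambda,$$ $$\alpha_{k+r}=\frac{\left(b_\ell^{(k)}-a_{[k]_{r+1}}^{(k)}\right)\prod_{i=1,\,i\neq[k]_{r+1}}^{r+1}a_i^{(k)}}{\left(b_\ell^{(k)}-1\right)\prod_{j=1}^{s}b_j^{(k)}}=\frac{\left(b'_k-a'_k\right)\prod_{i=1}^{r}a'_{k-i}}{\prod_{0\leq i\leq r,\ [k-i]_r\in\Lambda}b'_{k-i}}\qquad\text{if }[k]_r=\lambda_\ell\in\Lambda,$$ with $a'_k=a_{[k]_{r+1}}^{(k)}=a_{[k]_{r+1}}+\left\lceil\frac{k}{r+1}\right\rceil$, and $b'_k=b_l^{(k)}=b_l+\left\lceil\frac{k}{r}\right\rceil$ if $[k]_r=\lambda_l$. If $r\leq s$: $$\alpha_{k+s}=-\frac{\prod_{i=1}^{r+1}a_i^{(k)}}{\left(b_{[k]_s}^{(k)}-1\right)\prod_{j=1}^{s}b_j^{(k)}}=-\frac{\prod_{1\leq i\leq s,\ [k-i]_{s+1}\in\Sigma}a'_{k-i}}{\prod_{i=0}^{s}b'_{k-i}}\qquad\text{if }[k]_{s+1}\notin\Sigma,$$ $$\alpha_{k+s}=\frac{\left(b_{[k]_s}^{(k)}-a_\ell^{(k)}\right)\prod_{i=1,\,i\neq\ell}^{r+1}a_i^{(k)}}{\left(b_{[k]_s}^{(k)}-1\right)\prod_{j=1}^{s}b_j^{(k)}}=\frac{\left(b'_k-a'_k\right)\prod_{1\leq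 i\leq s,\ [k-i]_{s+1}\in\Sigma}a'_{k-i}}{\prod_{i=0}^{s}b'_{k-i}}\qquad\text{if }[k]_{s+1}=\sigma_\ell\in\Sigma,$$ with $a'_k=a_l^{(k)}=a_l+\left\lceil\frac{k}{s+1}\right\rceil$ if $[k]_{s+1}=\sigma_l$, and $b'_k=b_{[k]_s}^{(k)}=b_{[k]_s}+\left\lceil\frac{k}{s}\right\rceil$.
   Context: $\mathbb N=\{0,1,2,\dots\}$. Everything takes place over the commutative ring $\mathbb Q(b_1,\dots,b_s)[a_1,\dots,a_{r+1}]$ of polynomials in the indeterminates $a_1,\dots,a_{r+1}$ whose coefficients are rational functions in the indeterminates $b_1,\dots,b_s$. The Pochhammer symbol is $(z)_0=1$, $(z)_n=z(z+1)\cdots(z+n-1)$ for $n\ge1$, and $${}_pF_q\left(\left.\begin{matrix}c_1,\dots,c_p\\ d_1,\dots,d_q\end{matrix}\,\right|\,t\right)=\sum_{n=0}^\infty\frac{(c_1)_n\cdots(c_p)_n}{(d_1)_n\cdots(d_q)_n}\frac{t^n}{n!}$$ is treated as a formal power series. For integers $k$ and $n\ge1$, $[k]_n$ denotes the unique element of $\{1,\dots,n\}$ congruent to $k$ modulo $n$. The formulas for $a'_k,b'_k$ are used for all integers $k$ (also negative) via their last expressions. If $r=s$ then necessarily $\lambda_j=j$ and $\sigma_i=i$, and the two sets of formulas coincide. For a sequence $(\alpha_{k+m})_{k\in\mathbb N}$, a sequence $(f_k(t))_{k\in\mathbb N}$ of formal power series is said to admit the $m$-branched-continued-fraction representation with coefficients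 $(\alpha_{k+m})_{k\in\mathbb N}$ if for all $k\in\mathbb N$ $$f_k(t)=\cfrac{1}{1-\alpha_{k+m}\,t\prod\limits_{i_1=1}^{m}\cfrac{1}{1-\alpha_{k+m+i_1}\,t\prod\limits_{i_2=1}^{m}\cfrac{1}{1-\alpha_{k+m+i_1+i_2}\,t\prod\limits_{i_3=1}^{m}\cfrac{1}{1-\cdots}}}},$$ as formal power series in $t$. Equivalently, $f_k(t)=1+\alpha_{k+m}\,t\prod_{j=0}^{m}f_{k+j}(t)$ for all $k\in\mathbb N$; equivalently, $f_k(t)$ is the ordinary generating function (with $t$ marking $1/(m+1)$ of the length) of the $m$-Dyck paths at level $k$, i.e. lattice paths in $\mathbb N\times\mathbb N_{\ge k}$ starting (at abscissa $0$) and ending at height $k$ with steps $(1,1)$ of weight $1$ and steps $(1,-m)$ of weight $\alpha_i$ when starting from height $i$. *)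

(* Defs.v *)
From HB Require Import structures.
From mathcomp Require Import all_boot all_order all_algebra.
From mathcomp Require Import mpoly.

Set Implicit Arguments.
Unset Strict Implicit.
Unset Printing Implicit Defensive.

Import GRing.Theory.

Local Open Scope ring_scope.

(* Formal power series in t over a ring, as coefficient sequences. *)
Notation fps A := (nat -> A).

Section PowerSeries.

Variable A : comUnitRingType.
Implicit Types f g h : fps A.

Definition fps_one : fps A := fun n => (n == 0)%:R.

Definition fps_mul f g : fps A :=
  fun n => \sum_(i < n.+1) f i * g (n - i)%N.

Definition fps_sub f g : fps A := fun n => f n - g n.

(* c t f(t) *)
Definition fps_scale_shift (c : A) f : fps A :=
  fun n => if n is n'.+1 then c * f n' else 0.

(* The first n coefficients of 1 / h, obtained by solving (1 / h) h = 1
   recursively. *)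
Fixpoint fps_inv_coefs h (n : nat) : seq A :=
  if n is n'.+1 then
    let u := fps_inv_coefs h n' in
    rcons u (((n' == 0)%:R - \sum_(i < n') u`_i * h (n' - i)%N) / h 0)
  else [::].

Definition fps_inv h : fps A := fun n => (fps_inv_coefs h n.+1)`_n.

Definition fps_div f h : fps A := fps_mul f (fps_inv h).

Lemma size_fps_inv_coefs h n : size (fps_inv_coefs h n) = n.
Proof. by elim: n => //= n IHn; rewrite size_rcons IHn. Qed.

Lemma nth_fps_inv_coefs h n i :
  (i < n)%N -> (fps_inv_coefs h n)`_i = fps_inv h i.
Proof.
elim: n => // n IHn; rewrite ltnS leq_eqVlt => /predU1P[-> // | lt_in].
by rewrite /= nth_rcons size_fps_inv_coefs lt_in IHn.
Qed.

Lemma fps_mulVf h n :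
  h 0 \is a GRing.unit -> fps_mul (fps_inv h) h n = fps_one n.
Proof.
move=> h0U; rewrite /fps_mul /fps_one big_ord_recr /= subnn.
rewrite {2}/fps_inv /= nth_rcons size_fps_inv_coefs ltnn eqxx divrK //.
rewrite [X in _ + (_ - X)](_ : _ = \sum_(i < n) fps_inv h i * h (n - i)%N).
  by rewrite addrC subrK.
by apply: eq_bigr => i _; rewrite nth_fps_inv_coefs.
Qed.

(* The m-branched continued fraction started at index k, truncated after d
   levels by replacing the remaining fractions with 1. *)
Fixpoint bcf_convergent (m : nat) (alpha : nat -> A) (d k : nat) : fps A :=
  if d is d'.+1 then
    fps_inv (fps_sub fps_one
      (fps_scale_shift (alpha (k + m)%N)
        (\big[fps_mul/fps_one]_(1 <= i < m.+1)
           bcf_convergent m alpha d' (k + i))))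
  else fps_one.

(* The infinite fraction is the t-adic limit of its truncations: each
   coefficient is eventually constant. *)
Definition bcf_representation (m : nat) (f : nat -> fps A)
    (alpha : nat -> A) : Prop :=
  forall k n : nat, exists d0 : nat, forall d : nat, (d0 <= d)%N ->
    bcf_convergent m alpha d k n = f k n.

Definition pochhammer (z : A) (n : nat) : A := \prod_(i < n) (z + i%:R).

(* pFq with upper parameters cs and lower parameters ds. *)
Definition hypergeometric (cs ds : seq A) : fps A := fun n =>
  (\prod_(c <- cs) pochhammer c n) / (\prod_(d <- ds) pochhammer d n)
    / (n`!)%:R.

End PowerSeries.

(* The ceiling of k / n, for n >= 1. *)
Definition ceil_div (k : int) (n : nat) : int :=
  Num.ceil (k%:~R / n%:R : rat).

(* [k]_n, the element of {1, ..., n} congruent to k modulo n, for n >= 1. *)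
Definition bmod (k : int) (n : nat) : nat := `|((k - 1) %% n)%Z|%N.+1.

Lemma bmodP (k : int) (n : nat) : (0 < n)%N ->
  (0 < bmod k n <= n)%N /\ (bmod k n = k %[mod n])%Z.
Proof.
move=> n_gt0; have nz : (n : int) != 0 by rewrite eqz_nat -lt0n.
have ge0 := modz_ge0 (k - 1) nz.
have ltn : ((k - 1) %% n < n)%Z by apply: ltz_pmod.
split; first by rewrite /bmod /= -ltz_nat gez0_abs.
by rewrite /bmod -addn1 PoszD gez0_abs // modzDml subrK.
Qed.

(* All parameters below are indexed from 1. *)
Definition nth1 (l : seq nat) (j : nat) : nat := nth 0%N l j.-1.

Definition index1 (x : nat) (l : seq nat) : nat := (index x l).+1.

(* Q(b_1, ..., b_s) and Q(b_1, ..., b_s)[a_1, ..., a_{r+1}] *)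
Definition coef_field (s : nat) : fieldType := {fraction {mpoly rat[s]}}.

Definition coef_ring (r s : nat) : idomainType := {mpoly (coef_field s)[r.+1]}.

(* The value 0 outside the index range is never used. *)
Definition inda (r s i : nat) : coef_ring r s :=
  if insub i.-1 is Some o then 'X_(o : 'I_r.+1) : {mpoly (coef_field s)[r.+1]}
  else 0.

Definition indb (r s j : nat) : coef_ring r s :=
  if insub j.-1 is Some o then
    (tofrac ('X_(o : 'I_s) : {mpoly rat[s]}) : coef_field s)%:MP_[r.+1]
  else 0.

(* Case r >= s, with lam = [:: lambda_1; ...; lambda_s]. *)
Section CaseGe.

Variables (r s : nat) (lam : seq nat).

Definition a_ge (k : int) (i : nat) : coef_ring r s :=
  inda r s i + (ceil_div (k + 1 - i%:Z) r.+1)%:~R.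

Definition b_ge (k : int) (j : nat) : coef_ring r s :=
  indb r s j + (ceil_div (k + 1 - (nth1 lam j)%:Z) r)%:~R.

Definition g_ge (k : int) : fps (coef_ring r s) :=
  hypergeometric [seq a_ge k i | i <- iota 1 r.+1]
                 [seq b_ge k j | j <- iota 1 s].

Definition f_ge (k : nat) : fps (coef_ring r s) :=
  fps_div (g_ge k%:Z) (g_ge (k%:Z - 1)).

Definition a'_ge (k : int) : coef_ring r s :=
  inda r s (bmod k r.+1) + (ceil_div k r.+1)%:~R.

(* Meaningful only when [k]_r is some lambda_l. *)
Definition b'_ge (k : int) : coef_ring r s :=
  indb r s (index1 (bmod k r) lam) + (ceil_div k r)%:~R.

End CaseGe.

(* Case r <= s, with sig = [:: sigma_1; ...; sigma_r; s + 1]. *)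
Section CaseLe.

Variables (r s : nat) (sig : seq nat).

Definition a_le (k : int) (i : nat) : coef_ring r s :=
  inda r s i + (ceil_div (k + 1 - (nth1 sig i)%:Z) s.+1)%:~R.

Definition b_le (k : int) (j : nat) : coef_ring r s :=
  indb r s j + (ceil_div (k + 1 - j%:Z) s)%:~R.

Definition g_le (k : int) : fps (coef_ring r s) :=
  hypergeometric [seq a_le k i | i <- iota 1 r.+1]
                 [seq b_le k j | j <- iota 1 s].

Definition f_le (k : nat) : fps (coef_ring r s) :=
  fps_div (g_le k%:Z) (g_le (k%:Z - 1)).

(* Meaningful only when [k]_{s+1} is some sigma_l. *)
Definition a'_le (k : int) : coef_ring r s :=
  inda r s (index1 (bmod k s.+1) sig) + (ceil_div k s.+1)%:~R.

Definition b'_le (k : int) : coef_ring r s :=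
  indb r s (bmod k s) + (ceil_div k s)%:~R.

End CaseLe.

(* Main.v *)
(* Writing f_k = g_k / g_(k-1), the functional equation
   f_k = 1 + alpha_(k+m) t f_k f_(k+1) ... f_(k+m) telescopes to the linear
   relation g_k - g_(k-1) = alpha_(k+m) t g_(k+m).  Passing from g_(k-1) to g_k
   adds 1 to at most one numerator parameter and at most one denominator
   parameter, whereas the parameters of g_(k+m) are a_i^(k-1) + 1 and
   b_j^(k) + 1, so the relation is one of three elementary contiguous relations
   for hypergeometric series.  Both cases of the theorem are instances of one
   statement, in which the numerator parameters are shifted modulo m + 1 at the
   residues in a list La, the denominator parameters modulo m at the residues in
   Lb, and at every step at least one parameter is shifted. *)

Require Import Defs.
From HB Require Import structures.
From mathcomp Require Import all_boot all_order all_algebra.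
From mathcomp Require Import mpoly.
From mathcomp Require Import zify ring.
From Stdlib Require Import FunctionalExtensionality.

Set Implicit Arguments.
Unset Strict Implicit.
Unset Printing Implicit Defensive.

Import GRing.Theory Num.Theory.

Local Open Scope ring_scope.

(** * Ceilings, residues in {1, ..., n} and periodically shifted parameters *)

Section ShiftedParameters.

Lemma ceil_div_eq (k c : int) (n : nat) : (0 < n)%N ->
  (c - 1) * n%:Z < k <= c * n%:Z -> ceil_div k n = c.
Proof.
move=> n_gt0 /andP[lo hi]; apply: ceil_def.
have n0 : (0 : rat) < n%:R by rewrite ltr0n.
rewrite ltr_pdivlMr // ler_pdivrMr //.
by rewrite -[n%:R]/(n%:Z%:~R) -!rmorphM ltr_int ler_int lo.
Qed.

(** Division with the remainder taken in {1, ..., n}: in this form the ceiling of k / n is q + 1,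
    and this is how the ceilings below are evaluated. *)
Lemma int_bmod (k : int) (n : nat) : (0 < n)%N ->
  exists2 q : int, k = q * n%:Z + (bmod k n)%:Z & (0 < bmod k n <= n)%N.
Proof.
move=> n_gt0; have [le _] := bmodP k n_gt0; exists ((k - 1) %/ n)%Z => //.
rewrite /bmod; have n0 : n%:Z != 0 by rewrite eqz_nat -lt0n.
have := divz_eq (k - 1) n; have := modz_ge0 (k - 1) n0; lia.
Qed.

Lemma bmod_eq (k q : int) (n x : nat) : (0 < x <= n)%N ->
  k = q * n%:Z + x%:Z -> bmod k n = x.
Proof.
move=> le_xn Dk; have n_gt0 : (0 < n)%N by lia.
have [p Dk' le] := int_bmod k n_gt0.
have: p * n%:Z + (bmod k n)%:Z = q * n%:Z + x%:Z by rewrite -Dk'.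
move: (bmod k n) le => y le_yn E.
(* Distinct quotients would force the remainders apart by at least n, which is impossible inside {1,
   ..., n}. *)
have [|[]] : p = q \/ p + 1 <= q \/ q + 1 <= p by lia.
- by move=> Epq; rewrite Epq in E; lia.
- by nia.
- by nia.
Qed.

Lemma bmodBn k n : (0 < n)%N -> bmod (k - n%:Z) n = bmod k n.
Proof.
move=> n_gt0; have [q Dk le] := int_bmod k n_gt0.
by apply: (@bmod_eq _ (q - 1)) => //; rewrite {1}Dk; ring.
Qed.

Lemma bmodB_inj k n i j : (i < n)%N -> (j < n)%N ->
  bmod (k - i%:Z) n = bmod (k - j%:Z) n -> i = j.
Proof.
move=> lt_i lt_j E; have n_gt0 : (0 < n)%N by lia.
have [q Dk _] := int_bmod (k - i%:Z) n_gt0.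
have [p Dk' _] := int_bmod (k - j%:Z) n_gt0.
rewrite E in Dk; move: (bmod _ n) Dk Dk' => y Dk Dk'.
have [|[]] : p = q \/ p + 1 <= q \/ q + 1 <= p by lia.
- by move=> Epq; rewrite Epq in Dk'; lia.
- by nia.
- by nia.
Qed.

(** With k = q n + y and 1 <= y <= n, both ceilings are q if y < x and both are q + 1 if y > x. If y
    = x, the arguments are q n + 1 and q n, so the ceiling jumps exactly there. *)
Lemma ceil_divB k n x : (0 < x <= n)%N ->
  ceil_div (k + 1 - x%:Z) n
    = ceil_div (k - 1 + 1 - x%:Z) n + (bmod k n == x)%:Z.
Proof.
move=> lex; have n_gt0 : (0 < n)%N by lia.
have [q Dk le] := int_bmod k n_gt0.
case: (ltngtP (bmod k n) x) => [lt|lt|eq].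
- by rewrite !(@ceil_div_eq _ q) //; nia.
- by rewrite !(@ceil_div_eq _ (q + 1)) //; nia.
- by rewrite (@ceil_div_eq _ (q + 1)) ?(@ceil_div_eq _ q) //; nia.
Qed.

Lemma ceil_divDn k n : (0 < n)%N -> ceil_div (k + n%:Z) n = ceil_div k n + 1.
Proof.
move=> n_gt0; have [q Dk le] := int_bmod k n_gt0.
by rewrite (@ceil_div_eq _ (q + 2)) ?(@ceil_div_eq _ (q + 1)) //; nia.
Qed.

(** Writing k - i = q n + y with 1 <= y <= n, the other numerator is q n + i + 1; as i < n, both
    ceilings are q + 1. *)
Lemma ceil_div_bmod k n i : (i < n)%N ->
  ceil_div (k - i%:Z) n = ceil_div (k + 1 - (bmod (k - i%:Z) n)%:Z) n.
Proof.
move=> lt_in; have n_gt0 : (0 < n)%N by lia.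
have [q Dk le] := int_bmod (k - i%:Z) n_gt0.
move: (bmod _ n) Dk le => x Dk le.
by rewrite !(@ceil_div_eq _ (q + 1)) //; nia.
Qed.

(* Both parameter families of the theorem are instances of [param] and
   [param']: with L = 1, ..., N for the family whose members are all shifted
   in turn, and with L the list lambda or sigma for the other one. *)
Variables (A : comUnitRingType) (x : nat -> A) (N : nat) (L : seq nat).

Definition param (k : int) (j : nat) : A :=
  x j + (ceil_div (k + 1 - (nth1 L j)%:Z) N)%:~R.

Definition param' (k : int) : A :=
  x (index1 (bmod k N) L) + (ceil_div k N)%:~R.

Hypotheses (N_gt0 : (0 < N)%N) (L_uniq : uniq L).
Hypothesis (L_le : all (fun y => (1 <= y <= N)%N) L).

Lemma nth1_mem j : (1 <= j <= size L)%N -> nth1 L j \in L.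
Proof. by case/andP=> j_gt0 le; rewrite /nth1 mem_nth // prednK. Qed.

Lemma nth1K j : (1 <= j <= size L)%N -> index1 (nth1 L j) L = j.
Proof. by case/andP=> j_gt0 le; rewrite /index1 index_uniq // prednK. Qed.

Lemma nth1_inj i j : (1 <= i <= size L)%N -> (1 <= j <= size L)%N ->
  nth1 L i = nth1 L j -> i = j.
Proof. by move=> lei lej E; rewrite -(nth1K lei) E nth1K. Qed.

Lemma index1K y : y \in L ->
  (1 <= index1 y L <= size L)%N /\ nth1 L (index1 y L) = y.
Proof. by move=> yL; rewrite /index1 index_mem yL /nth1 /= nth_index. Qed.

Lemma nth1_bounds j : (1 <= j <= size L)%N -> (0 < nth1 L j <= N)%N.
Proof. by move=> le; have /(allP L_le) := nth1_mem le. Qed.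

Lemma paramB k j : (1 <= j <= size L)%N ->
  param k j = param (k - 1) j + (bmod k N == nth1 L j)%:R.
Proof.
by move=> le; rewrite /param ceil_divB ?nth1_bounds // intrD addrA.
Qed.

Lemma param_bump k l i : (1 <= l <= size L)%N -> (1 <= i <= size L)%N ->
  bmod k N = nth1 L l -> param k i = param (k - 1) i + (i == l)%:R.
Proof.
move=> lel lei E; rewrite paramB // E.
by congr (_ + (nat_of_bool _)%:R); apply/eqP/eqP => [/nth1_inj->|->].
Qed.

Lemma paramDN k j : param (k + N%:Z) j = param k j + 1.
Proof.
rewrite /param; have -> : k + N%:Z + 1 - (nth1 L j)%:Z
    = k + 1 - (nth1 L j)%:Z + N%:Z by ring.
by rewrite ceil_divDn // intrD addrA.
Qed.

Lemma param'BN k : param' (k - N%:Z) = param' k - 1.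
Proof.
by rewrite /param' bmodBn // -[in RHS](subrK N%:Z k) ceil_divDn // subrK intrD addrA addrK.
Qed.

(** The primed parameters at the indices k, k - 1, ..., k - N + 1 are unprimed ones all taken at the
    single index k. This links the two expressions for each alpha. *)
Lemma param'B k i l : (i < N)%N -> (1 <= l <= size L)%N ->
  bmod (k - i%:Z) N = nth1 L l -> param' (k - i%:Z) = param k l.
Proof.
move=> lt_in le E; rewrite /param' /param.
by rewrite (ceil_div_bmod k lt_in) E nth1K.
Qed.

Lemma param'0 k l : (1 <= l <= size L)%N ->
  bmod k N = nth1 L l -> param' k = param k l.
Proof. by move=> le E; have := @param'B k 0 l N_gt0 le; rewrite subr0; apply. Qed.

(** As i runs through 0, ..., N - 1, the residue of k - i takes each value in {1, ..., N} once, so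
    both products run over the residues in L satisfying P. *)
Lemma prod_param'B k (P : pred nat) :
  \prod_(0 <= i < N | (bmod (k - i%:Z) N \in L) && P (bmod (k - i%:Z) N))
     param' (k - i%:Z)
  = \prod_(1 <= j < (size L).+1 | P (nth1 L j)) param k j.
Proof.
(* Reading a parameter as a function of its residue turns both sides into products over residues. *)
pose F y := param k (index1 y L).
have -> : \prod_(1 <= j < (size L).+1 | P (nth1 L j)) param k j
   = \prod_(y <- L | P y) F y.
  rewrite big_add1 /= [RHS](big_nth 0%N) big_nat_cond [RHS]big_nat_cond.
  apply: eq_bigr => j /andP[/andP[_ lt_j] _].
  by rewrite /F -[L`_j]/(nth1 L j.+1) nth1K //; lia.
pose h i := bmod (k - i%:Z) N.
transitivity (\prod_(i <- iota 0 N | (h i \in L) && P (h i)) F (h i)).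
  rewrite /index_iota subn0 big_seq_cond [RHS]big_seq_cond.
  apply: eq_bigr => i /andP[]; rewrite mem_iota add0n => lt_in /andP[hL _].
  by have [le E] := index1K hL; apply: param'B.
rewrite -[LHS](big_map h (fun y => (y \in L) && P y) F) -big_filter_cond.
apply: perm_big; apply: uniq_perm => //.
  apply: filter_uniq; rewrite map_inj_in_uniq ?iota_uniq // => i j.
  by rewrite !mem_iota !add0n; apply: bmodB_inj.
move=> y; rewrite mem_filter andb_idr // => /(allP L_le) le.
(* The offset i with residue y is the residue of k - y itself, except that the residue N stands for
   the offset 0. *)
have [q Dk le'] := int_bmod (k - y%:Z) N_gt0.
have [E|ne] := eqVneq (bmod (k - y%:Z) N) N.
  apply/mapP; exists 0%N; first by rewrite mem_iota.
  by rewrite /h; symmetry; apply: (@bmod_eq _ (q + 1)) => //; nia.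
apply/mapP; exists (bmod (k - y%:Z) N); first by rewrite mem_iota; lia.
by rewrite /h; symmetry; apply: (@bmod_eq _ q) => //; nia.
Qed.

Lemma prod_param'B0 k :
  \prod_(0 <= i < N | bmod (k - i%:Z) N \in L) param' (k - i%:Z)
  = \prod_(1 <= j < (size L).+1) param k j.
Proof.
by rewrite -(prod_param'B k predT); apply: eq_bigl => i; rewrite andbT.
Qed.

(** Dropping i = 0 from a full period drops exactly the residue of k. *)
Lemma prod_param'B1 k :
  \prod_(1 <= i < N | bmod (k - i%:Z) N \in L) param' (k - i%:Z)
  = \prod_(1 <= j < (size L).+1 | nth1 L j != bmod k N) param k j.
Proof.
rewrite -(prod_param'B k (fun y => y != bmod k N)).
rewrite [RHS]big_mkcond big_ltn // subr0 eqxx andbF /= mul1r -big_mkcond /=.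
rewrite big_nat_cond [RHS]big_nat_cond; apply: eq_bigl => i.
have [/andP[lt0i lt_in] /=|//] := boolP (1 <= i < N)%N.
case: (_ \in L) => //=; symmetry; apply/eqP => E.
suff: i = 0%N by lia.
by apply: (@bmodB_inj k N) => //; rewrite subr0.
Qed.

(** The extra index i = N repeats the residue of k one period lower. It contributes the value at k
    minus 1, the source of the factors b - 1 in the denominators of alpha. *)
Lemma prod_param'B0r k : bmod k N \in L ->
  \prod_(0 <= i < N.+1 | bmod (k - i%:Z) N \in L) param' (k - i%:Z)
  = (param' k - 1) * \prod_(1 <= j < (size L).+1) param k j.
Proof.
move=> kL; rewrite big_mkcond big_nat_recr //= -big_mkcond /= prod_param'B0.
by rewrite bmodBn // kL param'BN mulrC.
Qed.

Lemma prod_param_notin k :  bmod k N \notin L ->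
  \prod_(1 <= j < (size L).+1 | nth1 L j != bmod k N) param k j
  = \prod_(1 <= j < (size L).+1) param k j.
Proof.
move=> kL; rewrite big_nat_cond [RHS]big_nat_cond; apply: eq_bigl => j.
case: (boolP (1 <= j < _)%N) => //= le; apply: contra kL => /eqP <-.
exact: nth1_mem.
Qed.

Lemma prod_param_nth1 k l : (1 <= l <= size L)%N -> bmod k N = nth1 L l ->
  \prod_(1 <= j < (size L).+1 | nth1 L j != bmod k N) param k j
  = \prod_(1 <= j < (size L).+1 | j != l) param k j.
Proof.
move=> le ->; rewrite big_nat_cond [RHS]big_nat_cond; apply: eq_bigl => j.
case: (boolP (1 <= j < _)%N) => //= lej; congr (~~ _).
by apply/eqP/eqP => [/nth1_inj->|->].
Qed.

End ShiftedParameters.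

(** * The family whose members are all shifted in turn, L = 1, ..., N *)

Section AllShifted.

Variables (A : comUnitRingType) (x : nat -> A) (N : nat).
Hypothesis N_gt0 : (0 < N)%N.

Lemma nth1_iota i : (1 <= i <= N)%N -> nth1 (iota 1 N) i = i.
Proof. by case: i => // i le; rewrite /nth1 nth_iota. Qed.

Lemma mem_bmod_iota k : bmod k N \in iota 1 N.
Proof. by have [le _] := bmodP k N_gt0; rewrite mem_iota add1n ltnS. Qed.

Lemma iota_bounds : all (fun y => (1 <= y <= N)%N) (iota 1 N).
Proof. by apply/allP => y; rewrite mem_iota add1n ltnS. Qed.

Lemma param_iota k i : (1 <= i <= N)%N ->
  param x N (iota 1 N) k i = x i + (ceil_div (k + 1 - i%:Z) N)%:~R.
Proof. by move=> le; rewrite /param nth1_iota. Qed.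

Lemma param'_iota k :
  param' x N (iota 1 N) k = x (bmod k N) + (ceil_div k N)%:~R.
Proof.
have [le _] := bmodP k N_gt0; congr (x _ + _).
by rewrite -{1}(nth1_iota le) nth1K ?iota_uniq ?size_iota.
Qed.

Lemma prod_param_iota k (P : pred nat) :
  \prod_(1 <= i < (size (iota 1 N)).+1 | P (nth1 (iota 1 N) i))
     param x N (iota 1 N) k i
  = \prod_(1 <= i < N.+1 | P i) (x i + (ceil_div (k + 1 - i%:Z) N)%:~R).
Proof.
rewrite size_iota big_nat_cond [RHS]big_nat_cond; apply: eq_big => i.
  by case: (boolP (1 <= i < _)%N) => //= le; rewrite nth1_iota.
by case/andP=> le _; rewrite param_iota.
Qed.

End AllShifted.

(** * Formal power series and convergence of the branched fraction *)

Section PowerSeriesTheory.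

Variable A : comUnitRingType.
Implicit Types f g h : fps A.

(** Low coefficients of a product depend only on truncations, so commutativity and associativity are
    inherited from polynomials. *)
Definition fps_trunc (n : nat) f : {poly A} := \poly_(i < n.+1) f i.

Lemma coef_fps_mul f g m n : (n <= m)%N ->
  fps_mul f g n = (fps_trunc m f * fps_trunc m g)`_n.
Proof.
move=> le; rewrite coefM; apply: eq_bigr => i _.
rewrite !coef_poly ltnS (leq_trans _ le) ?ltnS ?(leq_trans (leq_subr _ _)) //.
by rewrite -ltnS.
Qed.

Lemma fps_mulC : commutative (@fps_mul A).
Proof.
move=> f g; apply: functional_extensionality => n.
by rewrite !(@coef_fps_mul _ _ n n) // mulrC.
Qed.

Lemma fps_mulA : associative (@fps_mul A).
Proof.
move=> f g h; apply: functional_extensionality => n.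
transitivity (fps_trunc n f * (fps_trunc n g * fps_trunc n h))`_n.
  rewrite coefM; apply: eq_bigr => i _.
  rewrite coef_poly (ltn_ord i).
  by rewrite (@coef_fps_mul _ _ n) ?leq_subr.
rewrite mulrA coefM; apply: eq_bigr => i _.
by rewrite coef_poly ltnS leq_subr (@coef_fps_mul _ _ n) // -ltnS.
Qed.

Lemma fps_mul1f : left_id (@fps_one A) (@fps_mul A).
Proof.
move=> f; apply: functional_extensionality => n.
rewrite /fps_mul big_ord_recl /fps_one /= mul1r subn0 big1 ?addr0 // => i _.
by rewrite mul0r.
Qed.

HB.instance Definition _ :=
  Monoid.isComLaw.Build (fps A) (@fps_one A) (@fps_mul A)
    fps_mulA fps_mulC fps_mul1f.

Lemma fps_mulBr f g h :
  fps_mul f (fps_sub g h) = fps_sub (fps_mul f g) (fps_mul f h).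
Proof.
apply: functional_extensionality => n; rewrite /fps_sub /fps_mul -sumrB.
by apply: eq_bigr => i _; rewrite mulrBr.
Qed.

Lemma fps_mul_scale_shift c f g :
  fps_mul f (fps_scale_shift c g) = fps_scale_shift c (fps_mul f g).
Proof.
rewrite fps_mulC [in RHS]fps_mulC; apply: functional_extensionality => -[|n].
  by rewrite /fps_mul big_ord1 mul0r.
rewrite /fps_mul big_ord_recl mul0r add0r /= mulr_sumr.
by apply: eq_bigr => i _; rewrite mulrA.
Qed.

Lemma fps_inv_uniq f h :
  h 0%N \is a GRing.unit -> fps_mul f h = @fps_one A -> f = fps_inv h.
Proof.
move=> hU fh; rewrite -[RHS]fps_mul1f -fh -fps_mulA (fps_mulC h).
suff -> : fps_mul (fps_inv h) h = @fps_one A by rewrite fps_mulC fps_mul1f.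
by apply: functional_extensionality => n; apply: fps_mulVf.
Qed.

Lemma fps_divK f h : h 0%N \is a GRing.unit -> fps_mul (fps_div f h) h = f.
Proof.
move=> hU; rewrite /fps_div -fps_mulA.
suff -> : fps_mul (fps_inv h) h = @fps_one A by rewrite fps_mulC fps_mul1f.
by apply: functional_extensionality => n; apply: fps_mulVf.
Qed.

(** Congruence modulo t^n. *)
Definition eq_upto n f g := forall i, (i < n)%N -> f i = g i.

Lemma eq_upto_mul n f f' g g' :
  eq_upto n f f' -> eq_upto n g g' -> eq_upto n (fps_mul f g) (fps_mul f' g').
Proof.
move=> ff gg i lt_in; apply: eq_bigr => j _; rewrite ff ?gg //.
  exact: leq_ltn_trans (leq_subr _ _) lt_in.
exact: leq_trans (ltn_ord j) lt_in.
Qed.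

Lemma eq_upto_inv_coefs n h h' :
  eq_upto n h h' -> fps_inv_coefs h n = fps_inv_coefs h' n.
Proof.
elim: n => //= n IHn hh; rewrite IHn => [|i lt_in]; last exact/hh/ltnW.
congr (rcons _ ((_ - _) / _)); last exact: hh.
by apply: eq_bigr => i _; rewrite hh // ltnS leq_subr.
Qed.

Lemma eq_upto_inv n h h' :
  eq_upto n h h' -> eq_upto n (fps_inv h) (fps_inv h').
Proof.
move=> hh i lt_in; rewrite /fps_inv (@eq_upto_inv_coefs _ h h') // => j lt_j.
exact/hh/(leq_trans lt_j).
Qed.

(** The factor t gains one order of agreement per level of the fraction. *)
Lemma eq_upto_sub_scale_shift n c f g : eq_upto n f g ->
  eq_upto n.+1 (fps_sub (@fps_one A) (fps_scale_shift c f))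
               (fps_sub (@fps_one A) (fps_scale_shift c g)).
Proof. by move=> fg [|i] lt_i //; rewrite /fps_sub /= fg. Qed.

(* Each level of a convergent carries a factor t, so that d levels determine
   the first d + 1 coefficients. *)
Lemma bcf_convergent_upto m (alpha : nat -> A) (f : nat -> fps A) :
  (forall k, f k 0%N = 1) ->
  (forall k, f k = fps_inv (fps_sub (@fps_one A)
     (fps_scale_shift (alpha (k + m)%N)
        (\big[@fps_mul A/@fps_one A]_(1 <= i < m.+1) f (k + i)%N)))) ->
  forall d k, eq_upto d.+1 (bcf_convergent m alpha d k) (f k).
Proof.
move=> f0 fE; elim=> [|d IHd] k; first by case=> //= _; rewrite f0.
rewrite fE /=; apply: eq_upto_inv; apply: eq_upto_sub_scale_shift.
elim/big_ind2: _ => // *; exact: eq_upto_mul.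
Qed.

(** The telescoping product of the ratios g (i+1) / g i, cleared of denominators. *)
Lemma telescope_fps_prod m (g f : nat -> fps A) k :
  (forall i, fps_mul (f i) (g i) = g i.+1) ->
  fps_mul (\big[@fps_mul A/@fps_one A]_(1 <= i < m.+1) f (k + i)%N) (g k.+1)
  = g (k + m).+1.
Proof.
move=> fg; elim: m => [|m IHm]; first by rewrite big_geq // fps_mul1f addn0.
rewrite big_nat_recr //= (fps_mulC _ (f _)) -fps_mulA IHm addnS.
exact: fg.
Qed.

(* Dividing by g k the relation g (k+1) - g k = alpha t g (k+m+1) turns it into
   the functional equation f_k = 1 + alpha t f_k f_(k+1) ... f_(k+m). *)
Lemma bcf_of_contiguous m (alpha : nat -> A) (g f : nat -> fps A) :
  (forall k, g k 0%N = 1) ->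
  (forall k, f k = fps_div (g k.+1) (g k)) ->
  (forall k n,
     g k.+1 n - g k n = fps_scale_shift (alpha (k + m)%N) (g (k + m).+1) n) ->
  bcf_representation m f alpha.
Proof.
move=> g0 fE gE.
have gU k : g k 0%N \is a GRing.unit by rewrite g0 unitr1.
have fgK k : fps_mul (f k) (g k) = g k.+1 by rewrite fE fps_divK.
have f0 k : f k 0%N = 1.
  by have := congr1 (fun h => h 0%N) (fgK k); rewrite /fps_mul big_ord1 !g0 mulr1.
move=> k n; exists n => d le_nd; apply: bcf_convergent_upto => // {n d le_nd}k.
(* It remains to see that f_k (1 - alpha t f_(k+1) ... f_(k+m)) = 1. Pulling out 1 / g k and
   telescoping leaves (1 / g k) (g (k+1) - alpha t g (k+m+1)), and the bracket is g k. *)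
apply: fps_inv_uniq; first by rewrite /fps_sub /fps_one /= subr0 unitr1.
rewrite fE /fps_div -fps_mulA (fps_mulC (fps_inv _)) fps_mulA.
rewrite fps_mulBr fps_mul_scale_shift fps_mulC (fps_mulC _ (\big[_/_]_(_ <= _ < _) _)).
rewrite (telescope_fps_prod _ _ fgK) (fps_mulC _ (fps_one A)) fps_mul1f.
have -> : fps_sub (g k.+1) (fps_scale_shift (alpha (k + m)%N) (g (k + m).+1)) = g k.
  by apply: functional_extensionality => n; rewrite /fps_sub -gE opprB addrC subrK.
by apply: functional_extensionality => n; apply: fps_mulVf.
Qed.

End PowerSeriesTheory.

(** * Pochhammer products and the coefficientwise contiguous relation *)

Section ContiguousRelations.

Variable A : comUnitRingType.
Implicit Types (z c : A) (u w : nat -> A).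

Lemma pochhammerS z n : pochhammer z n.+1 = z * pochhammer (z + 1) n.
Proof.
rewrite /pochhammer big_ord_recl addr0; congr (_ * _).
by apply: eq_bigr => i _; rewrite lift0 -addrA nat1r.
Qed.

Lemma pochhammerSr z n : pochhammer z n.+1 = pochhammer z n * (z + n%:R).
Proof. by rewrite /pochhammer big_ord_recr. Qed.

Lemma prod_pochhammer u p n :
  \prod_(c <- [seq u i | i <- iota 1 p]) pochhammer c n
  = \prod_(1 <= i < p.+1) pochhammer (u i) n.
Proof. by rewrite big_map /index_iota subn1. Qed.

Lemma prod_pochhammerS u w p n :
  (forall i, (1 <= i <= p)%N -> w i = u i + 1) ->
  \prod_(1 <= i < p.+1) pochhammer (u i) n.+1
  = \prod_(1 <= i < p.+1) u i * \prod_(1 <= i < p.+1) pochhammer (w i) n.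
Proof.
move=> uw; rewrite -big_split /=; apply: eq_big_nat => i le.
by rewrite uw ?pochhammerS.
Qed.

Lemma prod_bump (F G : nat -> A) p l :
  (1 <= l <= p)%N -> (forall i, (1 <= i <= p)%N -> i != l -> F i = G i) ->
  \prod_(1 <= i < p.+1) F i = F l * \prod_(1 <= i < p.+1 | i != l) G i.
Proof.
move=> le FG; rewrite (bigD1_seq l) ?iota_uniq ?mem_index_iota //=.
congr (_ * _); rewrite big_nat_cond [RHS]big_nat_cond.
by apply: eq_bigr => i /andP[]; apply: FG.
Qed.

(** At the bumped index both sides contain (u_l)_(n+2), split off at its last factor on the left and
    at its first on the right. *)
Lemma prod_pochhammer_bump u w p l n : (1 <= l <= p)%N ->
  (forall i, (1 <= i <= p)%N -> w i = u i + (i == l)%:R) ->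
  \prod_(1 <= i < p.+1) pochhammer (u i) n.+1 * (u l + n.+1%:R)
  = u l * \prod_(1 <= i < p.+1) pochhammer (w i) n.+1.
Proof.
move=> le uw; have wu i : (1 <= i <= p)%N -> i != l -> w i = u i.
  by move=> lei /negPf ne; rewrite uw // ne addr0.
rewrite !(prod_bump (G := fun i => pochhammer (u i) n.+1) le) //; last first.
  by move=> i lei ne; rewrite wu.
by rewrite mulrAC -pochhammerSr pochhammerS uw // eqxx mulrA.
Qed.

(** For i != l both Pochhammer factors are w_i (v_i)_n. At l they are u_l (v_l)_n and (v_l)_n (u_l +
    n + 1), so the two products differ only by u_l against u_l + n + 1. *)
Lemma prod_pochhammer_bump_split u w v p l n : (1 <= l <= p)%N ->
  (forall i, (1 <= i <= p)%N -> w i = u i + (i == l)%:R) ->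
  (forall i, (1 <= i <= p)%N -> v i = u i + 1) ->
  \prod_(1 <= i < p.+1) pochhammer (u i) n.+1
    = \prod_(1 <= i < p.+1 | i != l) w i * u l
        * \prod_(1 <= i < p.+1) pochhammer (v i) n
  /\ \prod_(1 <= i < p.+1) pochhammer (w i) n.+1
    = \prod_(1 <= i < p.+1 | i != l) w i * (u l + n.+1%:R)
        * \prod_(1 <= i < p.+1) pochhammer (v i) n.
Proof.
move=> le uw uv; have wu i : (1 <= i <= p)%N -> i != l -> w i = u i.
  by move=> lei /negPf ne; rewrite uw // ne addr0.
split.
  rewrite (prod_pochhammerS _ uv) (prod_bump (G := w) le) => [|i lei ne].
    by rewrite [u l * _]mulrC.
  by rewrite wu.
rewrite (prod_bump (G := fun i => w i * pochhammer (v i) n) le) => [|i lei ne].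
  rewrite big_split /= (prod_bump (G := fun i => pochhammer (v i) n) le) //.
  have -> : w l = u l + 1 by rewrite uw // eqxx.
  by rewrite pochhammerSr uv // -nat1r; ring.
by rewrite pochhammerS wu // uv.
Qed.

(* N0 / D0, N1 / D1 and N2 / D2 are coefficients of g_(k-1), g_k and g_(k+m).
   When the numerator parameter A is shifted from g_(k-1) to g_k, X0 = A and
   X1 = A + nu, otherwise X0 = X1 = 1; when the denominator parameter B is
   shifted, Y0 = B and Y1 = B + nu, otherwise Y0 = Y1 = 1. *)
Lemma hypergeometric_diff_core (N0 N1 N2 D0 D1 D2 F nu pi beta X0 X1 Y0 Y1 c : A) :
  N0 = pi * X0 * N2 -> N1 = pi * X1 * N2 -> D1 = beta * D2 ->
  D0 * Y1 = Y0 * D1 -> X1 * Y0 - X0 * Y1 = c * nu ->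
  [/\ D2 \is a GRing.unit, F \is a GRing.unit,
      nu \is a GRing.unit & (beta \is a GRing.unit) && (Y0 \is a GRing.unit)] ->
  N1 / D1 / (nu * F) - N0 / D0 / (nu * F)
    = (c * pi) / (Y0 * beta) * (N2 / D2 / F).
Proof.
move=> -> -> E1 E0 Ec [D2U FU nuU /andP[bU YU]].
have D1U : D1 \is a GRing.unit by rewrite E1 unitrM bU.
(* [D0] and [Y1] are factors of the unit [Y0 * D1], hence units. *)
have := YU; rewrite -(unitrMl _ D1U) -E0 unitrM => /andP[D0U Y1U].
have -> : D0^-1 = Y1 / (Y0 * D1) by rewrite -E0 invrM // mulVKr.
rewrite E1 !invrM ?unitrM ?bU //.
(* With the inverses as atoms, only two cancellations have to be supplied to [ring]: [Y0] in the
   [X1] term and [nu] in [c]. *)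
set p := pi; set iY := Y0^-1; set ib := beta^-1; set iD := D2^-1.
set iF := F^-1; set inu := nu^-1.
have EY : X1 = X1 * Y0 * iY by rewrite mulrK.
have -> : c = (X1 * Y0 - X0 * Y1) * inu by rewrite Ec mulrK.
rewrite [in LHS]EY; ring.
Qed.

End ContiguousRelations.

(** * The common statement behind both cases of the theorem *)

Section BranchedFraction.

Variables (A : comUnitRingType) (m : nat) (xa xb : nat -> A) (La Lb : seq nat).
Hypotheses (m_gt0 : (0 < m)%N) (La_uniq : uniq La) (Lb_uniq : uniq Lb).
Hypothesis La_le : all (fun y => (1 <= y <= m.+1)%N) La.
Hypothesis Lb_le : all (fun y => (1 <= y <= m)%N) Lb.
Hypothesis xb_unit : forall j (z : int), (1 <= j <= size Lb)%N ->
  xb j + z%:~R \is a GRing.unit.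
Hypothesis nat_unit : forall n, (n.+1%:R : A) \is a GRing.unit.
Hypothesis La_or_Lb : forall k : int, (bmod k m.+1 \in La) || (bmod k m \in Lb).

Let a := param xa m.+1 La.
Let b := param xb m Lb.
Let a' := param' xa m.+1 La.

Let g (k : int) : fps A :=
  hypergeometric [seq a k i | i <- iota 1 (size La)]
                 [seq b k j | j <- iota 1 (size Lb)].

(** The filter omits the numerator parameter shifted at step k; if none is shifted, the product is
    full. *)
Let pi (k : int) := \prod_(1 <= i < (size La).+1 | nth1 La i != bmod k m.+1) a k i.
Let beta (k : int) := \prod_(1 <= j < (size Lb).+1) b k j.

Lemma hypergeometric_param0 k : g k 0%N = 1.
Proof.
rewrite /g /hypergeometric !prod_pochhammer fact0 divr1.
by rewrite !big1 ?divr1 // => i _; rewrite /pochhammer big_ord0.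
Qed.

Lemma fact_unit n : (n`!%:R : A) \is a GRing.unit.
Proof. by case: (n`!) (fact_gt0 n) => // p _; apply: nat_unit. Qed.

Lemma param_unit k j : (1 <= j <= size Lb)%N -> b k j \is a GRing.unit.
Proof. exact: xb_unit. Qed.

Lemma prod_param_unit k : beta k \is a GRing.unit.
Proof.
by rewrite /beta big_seq unitr_prod // => j; rewrite mem_index_iota; apply: param_unit.
Qed.

Lemma prod_pochhammer_unit k n :
  \prod_(1 <= j < (size Lb).+1) pochhammer (b k j) n \is a GRing.unit.
Proof.
rewrite big_seq unitr_prod => // j; rewrite mem_index_iota => le.
rewrite /pochhammer unitr_prod // => i _; rewrite /b /param -addrA.
by rewrite -[i%:R]/(i%:Z%:~R) -intrD xb_unit.
Qed.

(** The core identity with [nu] = n + 1 and [F] = n!. The factor [beta] comes from (b)_(n+1) = b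
    (b+1)_n, since index k + m is one full period of the denominator parameters above k. *)
Lemma hypergeometric_param_diff k n (X0 X1 Y0 Y1 c : A) :
  (\prod_(1 <= i < (size La).+1) pochhammer (a (k - 1) i) n.+1
     = pi k * X0 * \prod_(1 <= i < (size La).+1) pochhammer (a (k + m%:Z) i) n) ->
  (\prod_(1 <= i < (size La).+1) pochhammer (a k i) n.+1
     = pi k * X1 * \prod_(1 <= i < (size La).+1) pochhammer (a (k + m%:Z) i) n) ->
  (\prod_(1 <= j < (size Lb).+1) pochhammer (b (k - 1) j) n.+1 * Y1
     = Y0 * \prod_(1 <= j < (size Lb).+1) pochhammer (b k j) n.+1) ->
  X1 * Y0 - X0 * Y1 = c * n.+1%:R -> Y0 \is a GRing.unit ->
  g k n.+1 - g (k - 1) n.+1 = (c * pi k) / (Y0 * beta k) * g (k + m%:Z) n.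
Proof.
move=> E0 E1 EY Ec YU.
rewrite /g /hypergeometric !prod_pochhammer factS natrM.
apply: hypergeometric_diff_core E0 E1 _ EY Ec _.
  by apply: prod_pochhammerS => j _; apply: paramDN.
by split; rewrite ?prod_pochhammer_unit ?fact_unit ?nat_unit ?prod_param_unit.
Qed.

(** From k - 1 to k + m is one full period m + 1 of the numerator parameters. *)
Lemma aDm k i : a (k + m%:Z) i = a (k - 1) i + 1.
Proof.
rewrite /a -paramDN //; congr (param _ _ _ _ _).
by rewrite -addn1 PoszD addrACA addNr addr0.
Qed.

(** Let A and B be the shifted parameters before the shift and nu = n + 1. If only A is shifted, X1
    - X0 = nu and c = 1. If both are, (A + nu) B - A (B + nu) = (B - A) nu and c = B - A, which
    equals the difference after the shift. If only B is, Y0 - Y1 = -nu and c = -1. *)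
Lemma hypergeometric_param_contiguous (k : int) (alpha : A) :
  (bmod k m.+1 \in La -> bmod k m \notin Lb -> alpha = pi k / beta k) ->
  (forall l, bmod k m.+1 \in La -> (1 <= l <= size Lb)%N ->
     bmod k m = nth1 Lb l ->
     alpha = ((b k l - a' k) * pi k) / ((b k l - 1) * beta k)) ->
  (forall l, bmod k m.+1 \notin La -> (1 <= l <= size Lb)%N ->
     bmod k m = nth1 Lb l -> alpha = - (pi k / ((b k l - 1) * beta k))) ->
  forall n, g k n - g (k - 1) n = fps_scale_shift alpha (g (k + m%:Z)) n.
Proof.
move=> hA hB hC [|n]; first by rewrite !hypergeometric_param0 subrr.
have b1 l : (1 <= l <= size Lb)%N -> bmod k m = nth1 Lb l -> b k l - 1 = b (k - 1) l.
  by move=> le E; rewrite /b (param_bump _ _ _ le) // eqxx addrK.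
have := La_or_Lb k; have [kLa _|kLa /= kLb] := boolP (bmod k m.+1 \in La).
  have [le E] := index1K kLa; move: (index1 _ _) le (esym E) => i0 {E} lei Ei.
  have a'E : a' k = a (k - 1) i0 + 1.
    by rewrite /a' (param'0 _ _ _ lei) // (param_bump _ _ _ lei) // eqxx.
  have piE : pi k = \prod_(1 <= i < (size La).+1 | i != i0) a k i.
    exact: prod_param_nth1.
  have [E0 E1] := prod_pochhammer_bump_split n lei
    (fun i lei' => param_bump xa La_uniq La_le lei lei' Ei) (fun i _ => aDm k i).
  rewrite -piE in E0 E1.
  have [kLb|kLb] := boolP (bmod k m \in Lb); last first.
    rewrite /= hA // -[X in X / _]mul1r -[X in _ / X]mul1r.
    apply: (hypergeometric_param_diff (Y1 := 1) E0 E1 _ _ (unitr1 A)).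
      rewrite mulr1 mul1r; apply: eq_big_nat => j le; congr (pochhammer _ _).
      rewrite [RHS]/b paramB //; case: eqP => [E|_]; last by rewrite addr0.
      by rewrite E nth1_mem in kLb.
    by ring.
  have [le E] := index1K kLb; move: (index1 _ _) le (esym E) => j0 {E} lej Ej.
  rewrite /= (hB j0) // b1 //.
  apply: (hypergeometric_param_diff E0 E1 _ _ (param_unit _ lej)).
    apply: (prod_pochhammer_bump _ lej) => j lej'; exact: param_bump Ej.
  by rewrite -/a a'E -b1 //; ring.
have [le E] := index1K kLb; move: (index1 _ _) le (esym E) => j0 {E} lej Ej.
rewrite /= (hC j0) // b1 // -[- (pi k / _)]mulN1r (mulrA (-1)).
have aE i : (1 <= i <= size La)%N -> a k i = a (k - 1) i.
  move=> le; rewrite /a paramB //; case: eqP => [E|_]; last by rewrite addr0.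
  by rewrite E nth1_mem in kLa.
have piE : pi k = \prod_(1 <= i < (size La).+1) a k i by apply: prod_param_notin.
have E0 : \prod_(1 <= i < (size La).+1) pochhammer (a k i) n.+1
    = pi k * 1 * \prod_(1 <= i < (size La).+1) pochhammer (a (k + m%:Z) i) n.
  by rewrite mulr1 piE; apply: prod_pochhammerS => i lei; rewrite aDm aE.
apply: (hypergeometric_param_diff (X0 := 1) (Y1 := b (k - 1) j0 + n.+1%:R)
          _ E0 _ _ (param_unit _ lej)).
- by rewrite -[RHS]E0; apply: eq_big_nat => i lei; rewrite aE.
- apply: (prod_pochhammer_bump _ lej) => j lej'; exact: param_bump Ej.
- by ring.
Qed.

Lemma bcf_hypergeometric_param (alpha : nat -> A) :
  (forall k : nat, bmod k m.+1 \in La -> bmod k m \notin Lb ->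
     alpha (k + m)%N = pi k / beta k) ->
  (forall k l : nat, bmod k m.+1 \in La -> (1 <= l <= size Lb)%N ->
     bmod k m = nth1 Lb l ->
     alpha (k + m)%N = ((b k l - a' k) * pi k) / ((b k l - 1) * beta k)) ->
  (forall k l : nat, bmod k m.+1 \notin La -> (1 <= l <= size Lb)%N ->
     bmod k m = nth1 Lb l ->
     alpha (k + m)%N = - (pi k / ((b k l - 1) * beta k))) ->
  bcf_representation m (fun k => fps_div (g k%:Z) (g (k%:Z - 1))) alpha.
Proof.
move=> hA hB hC.
(* The sequence is reindexed so that position 0 holds the series of index -1. *)
apply: (@bcf_of_contiguous _ _ _ (fun k => g (k%:Z - 1))) => [k|k|k n].
- exact: hypergeometric_param0.
- by rewrite -addn1 PoszD addrK.
- rewrite -(addn1 k) -(addn1 (k + m)) !PoszD !addrK.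
  apply: hypergeometric_param_contiguous => [|l|l].
  + exact: hA.
  + exact: hB.
  + exact: hC.
Qed.

End BranchedFraction.

(** * Invertibility of the denominators in the coefficient ring *)

Section Units.

Variables r s : nat.

(** The coefficient of b_j in b_j + z is 1, so this element of the field of rational functions is
    nonzero, and a nonzero constant polynomial over a field is a unit. *)
Lemma indb_unit j (z : int) : (1 <= j <= s)%N ->
  indb r s j + z%:~R \is a GRing.unit.
Proof.
case: j => // j lt_js; rewrite /indb insubT /=.
rewrite -[z%:~R](rmorph_int (@mpolyC r.+1 (coef_field s))) -rmorphD rmorph_unit //.
rewrite unitfE -(rmorph_int (@tofrac {mpoly rat[s]})) -rmorphD tofrac_eq0.
apply/eqP => /(congr1 (mcoeff U_(Ordinal lt_js))).
rewrite mcoeffD mcoeffX eqxx -(rmorph_int (@mpolyC s rat)) mcoeffC mcoeff0.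
by rewrite mnm1_eq0 mulr0 addr0 => /eqP; rewrite oner_eq0.
Qed.

Lemma nat_coef_ring_unit n : (n.+1%:R : coef_ring r s) \is a GRing.unit.
Proof.
rewrite -(rmorph_nat (@mpolyC r.+1 (coef_field s))) rmorph_unit //.
rewrite unitfE -(rmorph_nat (@tofrac {mpoly rat[s]})) tofrac_eq0 -(rmorph_nat (@mpolyC s rat)).
by rewrite mpolyC_eq0 pnatr_eq0.
Qed.

End Units.

(** * Specialization to r >= s and to r <= s *)

Theorem theorem5p5 (r s : nat) (m_ge1 : (1 <= maxn r s)%N) :
  ((s <= r)%N ->
   forall lam : s.-tuple nat,
   sorted ltn lam -> all (fun x => (1 <= x <= r)%N) lam ->
   let a := @a_ge r s in
   let b := @b_ge r s lam in
   let a' := @a'_ge r s in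
   let b' := @b'_ge r s lam in
   forall alpha : nat -> coef_ring r s,
   (forall k : nat, bmod k r \notin lam ->
      alpha (k + r)%N =
        (\prod_(1 <= i < r.+2 | i != bmod k r.+1) a k i)
          / \prod_(1 <= j < s.+1) b k j) ->
   (forall k l : nat, (1 <= l <= s)%N -> bmod k r = nth1 lam l ->
      alpha (k + r)%N =
        ((b k l - a k (bmod k r.+1))
           * \prod_(1 <= i < r.+2 | i != bmod k r.+1) a k i)
          / ((b k l - 1) * \prod_(1 <= j < s.+1) b k j)) ->
   [/\ bcf_representation (maxn r s) (@f_ge r s lam) alpha,
       forall k : nat, bmod k r \notin lam ->
         alpha (k + r)%N =
           (\prod_(1 <= i < r.+1) a' (k%:Z - i%:Z))
             / \prod_(1 <= i < r | bmod (k%:Z - i%:Z) r \in lam)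
                 b' (k%:Z - i%:Z),
       forall k : nat, bmod k r \in lam ->
         alpha (k + r)%N =
           ((b' k - a' k) * \prod_(1 <= i < r.+1) a' (k%:Z - i%:Z))
             / \prod_(0 <= i < r.+1 | bmod (k%:Z - i%:Z) r \in lam)
                 b' (k%:Z - i%:Z),
       forall k : int, (-1 <= k)%R -> a' k = a k (bmod k r.+1)
     & forall (k : int) (l : nat), (-1 <= k)%R -> (1 <= l <= s)%N ->
         bmod k r = nth1 lam l -> b' k = b k l])
  /\
  ((r <= s)%N ->
   forall sig0 : r.-tuple nat,
   sorted ltn sig0 -> all (fun x => (1 <= x <= s)%N) sig0 ->
   let sig := rcons sig0 s.+1 in
   let a := @a_le r s sig in
   let b := @b_le r s in
   let a' := @a'_le r s sig in
   let b' := @b'_le r s in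
   forall alpha : nat -> coef_ring r s,
   (forall k : nat, bmod k s.+1 \notin sig ->
      alpha (k + s)%N =
        - ((\prod_(1 <= i < r.+2) a k i)
             / ((b k (bmod k s) - 1) * \prod_(1 <= j < s.+1) b k j))) ->
   (forall k l : nat, (1 <= l <= r.+1)%N -> bmod k s.+1 = nth1 sig l ->
      alpha (k + s)%N =
        ((b k (bmod k s) - a k l) * \prod_(1 <= i < r.+2 | i != l) a k i)
          / ((b k (bmod k s) - 1) * \prod_(1 <= j < s.+1) b k j)) ->
   [/\ bcf_representation (maxn r s) (@f_le r s sig) alpha,
       forall k : nat, bmod k s.+1 \notin sig ->
         alpha (k + s)%N =
           - ((\prod_(1 <= i < s.+1 | bmod (k%:Z - i%:Z) s.+1 \in sig)
                 a' (k%:Z - i%:Z))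
                / \prod_(0 <= i < s.+1) b' (k%:Z - i%:Z)),
       forall k : nat, bmod k s.+1 \in sig ->
         alpha (k + s)%N =
           ((b' k - a' k)
              * \prod_(1 <= i < s.+1 | bmod (k%:Z - i%:Z) s.+1 \in sig)
                  a' (k%:Z - i%:Z))
             / \prod_(0 <= i < s.+1) b' (k%:Z - i%:Z),
       forall (k : int) (l : nat), (-1 <= k)%R -> (1 <= l <= r.+1)%N ->
         bmod k s.+1 = nth1 sig l -> a' k = a k l
     & forall k : int, (-1 <= k)%R -> b' k = b k (bmod k s)]).
Proof.
split=> [le_sr lam lam_sorted lam_le a b a' b' alpha hA hB
        |le_rs sig0 sig_sorted sig_le sig a b a' b' alpha hC hB].
- have r_gt0 : (0 < r)%N by move: m_ge1; rewrite (maxn_idPl le_sr).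
  have lam_uniq : uniq lam by apply: sorted_uniq lam_sorted; [apply: ltn_trans|apply: ltnn].
  have a'E k : a' k = param' (inda r s) r.+1 (iota 1 r.+1) k.
    by rewrite param'_iota.
  (* For r >= s some numerator parameter is shifted at every step, so the case of a lone denominator
     shift is void. *)
  have kLa k : bmod k r.+1 \in iota 1 r.+1 by apply: mem_bmod_iota.
  have prod_b k : \prod_(1 <= j < (size lam).+1) param (indb r s) r lam k j
      = \prod_(1 <= j < s.+1) b k j.
    by rewrite size_tuple.
  have prod_a k : \prod_(1 <= i < (size (iota 1 r.+1)).+1
        | nth1 (iota 1 r.+1) i != bmod k r.+1)
        param (inda r s) r.+1 (iota 1 r.+1) k i
      = \prod_(1 <= i < r.+2 | i != bmod k r.+1) a k i.
    exact: (prod_param_iota _ _ _ (fun i => i != bmod k r.+1)).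
  have prod_a' (k : int) : \prod_(1 <= i < r.+1) a' (k - i%:Z)
      = \prod_(1 <= i < r.+2 | i != bmod k r.+1) a k i.
    rewrite -prod_a -prod_param'B1 ?iota_uniq ?iota_bounds //.
    by apply: eq_big => i; rewrite ?kLa // a'E.
  have b'E k l : (1 <= l <= s)%N -> bmod k r = nth1 lam l -> b' k = b k l.
    by move=> le; apply: param'0; rewrite ?size_tuple.
  have a'k (k : int) : a' k = a k (bmod k r.+1).
    have [le _] := bmodP k (ltn0Sn r).
    rewrite a'E (@param'0 _ _ _ _ _ _ _ (bmod k r.+1)) ?param_iota ?iota_uniq ?size_iota //.
    by rewrite nth1_iota.
  have bE k l : param (indb r s) r lam k l = b k l by [].
  (* Since the residue of k is not in [lam], starting the range at 1 loses no parameter. *)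
  have prod_b'1 (k : int) : bmod k r \notin lam ->
      \prod_(1 <= i < r | bmod (k - i%:Z) r \in lam) b' (k - i%:Z)
      = \prod_(1 <= j < s.+1) b k j.
    by move=> kL; rewrite -prod_b -(prod_param_notin _ kL) -prod_param'B1.
  have prod_b'0 (k : int) : bmod k r \in lam ->
      \prod_(0 <= i < r.+1 | bmod (k - i%:Z) r \in lam) b' (k - i%:Z)
      = (b' k - 1) * \prod_(1 <= j < s.+1) b k j.
    by move=> kL; rewrite -prod_b -prod_param'B0r.
  clearbody a b a' b'; split=> [|k kL|k kL|k _|k l _ le E].
  + rewrite (maxn_idPl le_sr).
    have gE k : g_ge r s lam k = hypergeometric
        [seq param (inda r s) r.+1 (iota 1 r.+1) k i | i <- iota 1 (size (iota 1 r.+1))]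
        [seq param (indb r s) r lam k j | j <- iota 1 (size lam)].
      rewrite /g_ge size_iota size_tuple; congr (hypergeometric _ _).
      apply/eq_in_map => i; rewrite mem_iota add1n ltnS => le.
      by rewrite param_iota.
    suff: bcf_representation r
        (fun k => fps_div (g_ge r s lam k%:Z) (g_ge r s lam (k%:Z - 1))) alpha by [].
    under [X in bcf_representation _ X]functional_extensionality => k do rewrite !gE.
    apply: bcf_hypergeometric_param => //.
    * exact: iota_uniq.
    * exact: iota_bounds.
    * by move=> j z; rewrite size_tuple; apply: indb_unit.
    * exact: nat_coef_ring_unit.
    * by move=> k; rewrite kLa.
    * by move=> k _ kL; rewrite prod_a prod_b; apply: hA.
    * move=> k l _ le E; rewrite prod_a prod_b bE -a'E a'k.
      by apply: hB; rewrite // -(size_tuple lam).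
    * by move=> k l; rewrite kLa.
  + by rewrite prod_a' prod_b'1 // hA.
  + have [] := index1K kL; rewrite size_tuple => le E.
    by rewrite prod_a' prod_b'0 // (b'E _ _ le (esym E)) a'k; apply: hB.
  + exact: a'k.
  + exact: b'E.
- have s_gt0 : (0 < s)%N by move: m_ge1; rewrite (maxn_idPr le_rs).
  have size_sig : size sig = r.+1 by rewrite size_rcons size_tuple.
  have sig_uniq : uniq sig.
    rewrite rcons_uniq (sorted_uniq ltn_trans ltnn) // andbT.
    (* The appended entry s + 1 exceeds every sigma_i. *)
    by apply/negP => /(allP sig_le); rewrite ltnn andbF.
  have sig_bounds : all (fun y => (1 <= y <= s.+1)%N) sig.
    rewrite all_rcons ltn0Sn leqnn; apply: sub_all sig_le => y /andP[-> le].
    exact: leqW.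
  (* For r <= s the roles are exchanged: a denominator parameter is shifted at every step, so the
     case of a lone numerator shift is void. *)
  have kLb k : bmod k s \in iota 1 s by apply: mem_bmod_iota.
  have b'E k : b' k = param' (indb r s) s (iota 1 s) k by rewrite param'_iota.
  have bE k j : (1 <= j <= s)%N -> param (indb r s) s (iota 1 s) k j = b k j.
    by move=> le; rewrite param_iota.
  have prod_b k : \prod_(1 <= j < (size (iota 1 s)).+1)
        param (indb r s) s (iota 1 s) k j
      = \prod_(1 <= j < s.+1) b k j.
    exact: (prod_param_iota _ _ _ predT).
  have b'k (k : int) : b' k = b k (bmod k s).
    have [le _] := bmodP k s_gt0.
    rewrite b'E (@param'0 _ _ _ _ _ _ _ (bmod k s)) ?bE ?iota_uniq ?size_iota //.
    by rewrite nth1_iota.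
  have prod_b' (k : int) : \prod_(0 <= i < s.+1) b' (k - i%:Z)
      = (b k (bmod k s) - 1) * \prod_(1 <= j < s.+1) b k j.
    rewrite -prod_b -b'k b'E -prod_param'B0r ?iota_uniq ?iota_bounds //.
    by apply: eq_big => i; rewrite ?kLb // b'E.
  have prod_a k l : (1 <= l <= r.+1)%N -> bmod k s.+1 = nth1 sig l ->
      \prod_(1 <= i < (size sig).+1 | nth1 sig i != bmod k s.+1)
        param (inda r s) s.+1 sig k i
      = \prod_(1 <= i < r.+2 | i != l) a k i.
    by move=> le E; rewrite (prod_param_nth1 _ sig_uniq _ E) ?size_sig.
  have prod_a0 k : bmod k s.+1 \notin sig ->
      \prod_(1 <= i < (size sig).+1 | nth1 sig i != bmod k s.+1)
        param (inda r s) s.+1 sig k i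
      = \prod_(1 <= i < r.+2) a k i.
    by move=> kL; rewrite prod_param_notin ?size_sig.
  have a'E k l : (1 <= l <= r.+1)%N -> bmod k s.+1 = nth1 sig l -> a' k = a k l.
    by move=> le; apply: param'0; rewrite ?size_sig.
  have aE k l : param (inda r s) s.+1 sig k l = a k l by [].
  have a'pE k : param' (inda r s) s.+1 sig k = a' k by [].
  have prod_a' (k : int) :
      \prod_(1 <= i < s.+1 | bmod (k - i%:Z) s.+1 \in sig) a' (k - i%:Z)
      = \prod_(1 <= i < (size sig).+1 | nth1 sig i != bmod k s.+1)
          param (inda r s) s.+1 sig k i.
    by rewrite -prod_param'B1.
  clearbody a b a' b'; split=> [|k kL|k kL|k l _ le E|k _].
  + rewrite (maxn_idPr le_rs).
    have gE k : g_le r s sig k = hypergeometric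
        [seq param (inda r s) s.+1 sig k i | i <- iota 1 (size sig)]
        [seq param (indb r s) s (iota 1 s) k j | j <- iota 1 (size (iota 1 s))].
      rewrite /g_le size_iota size_sig; congr (hypergeometric _ _).
      apply/eq_in_map => j; rewrite mem_iota add1n ltnS => le.
      by rewrite param_iota.
    suff: bcf_representation s
        (fun k => fps_div (g_le r s sig k%:Z) (g_le r s sig (k%:Z - 1))) alpha by [].
    under [X in bcf_representation _ X]functional_extensionality => k do rewrite !gE.
    apply: bcf_hypergeometric_param => //.
    * exact: iota_uniq.
    * exact: iota_bounds.
    * by move=> j z; rewrite size_iota; apply: indb_unit.
    * exact: nat_coef_ring_unit.
    * by move=> k; rewrite kLb orbT.
    * by move=> k _; rewrite kLb.
    * move=> k l kL le; have le' : (1 <= l <= s)%N by rewrite -(size_iota 1 s).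
      rewrite nth1_iota // => E; have [lei /esym Ei] := index1K kL.
      rewrite size_sig in lei.
      rewrite (prod_a _ _ lei Ei) prod_b bE // a'pE (a'E _ _ lei Ei) -E.
      exact: hB.
    * move=> k l kL le; have le' : (1 <= l <= s)%N by rewrite -(size_iota 1 s).
      rewrite nth1_iota // => E.
      by rewrite prod_a0 // prod_b bE // -E; apply: hC.
  + by rewrite prod_b' prod_a' prod_a0 // hC.
  + have [] := index1K kL; rewrite size_sig => le E.
    rewrite prod_b' prod_a' (prod_a _ _ le (esym E)).
    by rewrite (a'E _ _ le (esym E)) b'k; apply: hB.
  + exact: a'E.
  + exact: b'k.
Qed.
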